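(* The augmented column generation algorithm with adaptive ng-relaxations and subset-row cuts described in the context terminates in finitely many iterations. Steps 1--4 alone (that is, stopping the first time the relaxation solution $z^t$ is supported on elementary paths, without adding any subset-row cut) return the value $\overline{\mathtt{OPT}}(\mathcal P_{\rm elem})$. Steps 1--5 return a relaxation solution of value $\mathtt{OPT}$ with $$\overline{\mathtt{OPT}}(\mathcal P_{\rm elem})\ \le\ \mathtt{OPT}\ \le\ \mathtt{OPT}(\mathcal P_{\rm elem}).$$
   Context: **Instance.** $(\mathcal V,\mathcal A)$ is a finite directed graph, $\mathcal V=\mathcal V_C\cup\mathcal V_D\cup\mathcal V_S$ a partition into customers, depots and charging stations; $T$ is the time horizon, $B$ the battery capacity, $D$ the vehicle capacity. Each arc $(i,j)$ ($i\ne j$) has travel time $t_{i,j}>0$, cost $c_{i,j}>0$, battery use $b_{i,j}>0$. Each node $i$ has demand $d_i\ge 0$ and time window $[\alpha_i,\beta_i]\subseteq[0,T]$; for $i\in\mathcal V_D\cup\mathcal V_S$, $d_i=0$, $\alpha_i=0$, $\beta_i=T$. For each depot $j$, $v^{\rm start}_j,v^{\rm end}_j$ are nonnegative integers. The charging function $g:\mathbb R_+\to[0,B]$ is concave, increasing, $g(0)=0$, and invertible: it is continuous, strictly increasing until it attains $B$, and $g^{-1}(b)$ is the smallest $t$ with $g(t)=b$. Set $g_C(b,t)=g(g^{-1}(b)+t)$. **Paths.** A path $p$ is a node sequence $(n_0,\dots,n_m)$ along arcs with $n_0,n_m\in\mathcal V_D$ and $n_1,\dots,n_{m-1}\in\mathcal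 V_C\cup\mathcal V_S$. It is feasible if there are charging times $\tau_k\ge0$ ($n_k\in\mathcal V_S$; put $\tau_k=0$ otherwise) such that with $t_0=0$, $b_0=B$, $t_{k+1}=\max\{t_k+\tau_k+t_{n_k,n_{k+1}},\alpha_{n_{k+1}}\}$, and $b_{k+1}=g_C(b_k,\tau_k)-b_{n_k,n_{k+1}}$ if $n_k\in\mathcal V_S$, $b_{k+1}=b_k-b_{n_k,n_{k+1}}$ otherwise, one has $\sum_k d_{n_k}\le D$, $b_k\in[0,B]$, $t_k\in[\alpha_{n_k},\beta_{n_k}]$ for all $k$. $c^p$ is the sum of arc costs; $\gamma_i^p$ the number of visits to $i\in\mathcal V_C$; $\sigma^p_{j,\rm start},\sigma^p_{j,\rm end}\in\{0,1\}$ indicate whether $p$ starts, ends at depot $j$. A feasible path is elementary if $\gamma_i^p\le1$ for all $i\in\mathcal V_C$; $\mathcal P_{\rm elem}$ is the set of feasible elementary paths. **Master problem.** For a set $\mathcal P'$ of feasible paths, $\mathtt{EVRP}(\mathcal P')$ is: minimize $\sum_{p\in\mathcal P'}c^pz^p$ subject to $\sum_p\sigma^p_{j,\rm start}z^p=v_j^{\rm start}$ and $\sum_p\sigma^p_{j,\rm end}z^p\ge v_j^{\rm end}$ for all $j\in\mathcal V_D$, $\sum_p\gamma_i^pz^p=1$ for all $i\in\mathcal V_C$, $z^p\in\{0,1\}$. Its optimal value is $\mathtt{OPT}(\mathcal P')$. $\overline{\mathtt{EVRP}}(\mathcal P')$ is its linear relaxation ($z\ge0$), with value $\overline{\mathtt{OPT}}(\mathcal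 P')$. **ng-neighborhoods.** $\mathcal N=\{N_i\subseteq\mathcal V:i\in\mathcal V\}$ with $i\in N_i$; $N_i\subseteq\mathcal V_C$ for $i\in\mathcal V_C$; $N_i\subseteq\mathcal V_C\cup\{i\}$ for $i\in\mathcal V_D\cup\mathcal V_S$. $(n_0,\dots,n_m)$ is ng-feasible if for every $j<k$ with $n_j=n_k$ there is $j<\ell<k$ with $n_j\notin N_{n_\ell}$. $\mathcal P(\mathcal N)$ is the set of feasible paths whose node sequence is ng-feasible. **Subset-row cuts.** For $S\subseteq\mathcal V_C$ with $|S|=3$ and $w_i=\tfrac12$ for $i\in S$: $\sum_p\lfloor\sum_{i\in S}w_i\gamma_i^p\rfloor z^p\le\lfloor\sum_{i\in S}w_i\rfloor$. **Algorithm.** Initialize with an ng-neighborhood $\mathcal N^0$, cut set $\mathcal Q=\emptyset$, $\mathcal P^0_{\rm init}\subseteq\mathcal P(\mathcal N^0)$, $t=0$. Repeat: - Step 1: solve $\overline{\mathtt{EVRP}}(\mathcal P(\mathcal N^t))$ with the cuts $\mathcal Q$ by column generation started from $\mathcal P^t_{\rm init}$ (alternating: solve the linear program restricted to the current path set; add paths of $\mathcal P(\mathcal N^t)$ of negative reduced cost, or stop if none exists). Obtain an optimal solution $z^t$ and the generated path set $\mathcal P^t\subseteq\mathcal P(\mathcal N^t)$. - Step 2: solve $\mathtt{EVRP}(\mathcal P^t)$ with integrality (a primal heuristic), with solution $z^t_I$. - Step 3: if $z^t$ is supported on elementary paths and violates no subset-row cut, stop and return $z^t$, $z_I^t$ and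 their values. - Step 4 (elementarity): if $z^t$ is not supported on elementary paths, then for each non-elementary path $p$ in the support of $z^t$ and every cycle $(i,n_1,\dots,n_m,i)$ with $i\in\mathcal V_C$ in its node sequence, add $i$ to $N_{n_1},\dots,N_{n_m}$; this defines $\mathcal N^{t+1}$. Set $\mathcal P^{t+1}_{\rm init}=\mathcal P^t\cap\mathcal P(\mathcal N^{t+1})$, increment $t$, go to Step 1. - Step 5 (integrality): otherwise, find a subset-row cut violated by $z^t$, add it to $\mathcal Q$, set $\mathcal P^{t+1}_{\rm init}=\mathcal P^t$ (and $\mathcal N^{t+1}=\mathcal N^t$), increment $t$, go to Step 1. As required by column generation, the restricted linear programs are assumed feasible at initialization of each Step 1. $\mathtt{OPT}$ denotes the value of the relaxation solution $z^t$ at termination. *)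

(* Defs.v *)
From HB Require Import structures.
From mathcomp Require Export all_boot all_order all_algebra.
From mathcomp Require Export mathcomp_extra boolp classical_sets functions.
From mathcomp Require Export cardinality set_interval fsbigop reals ereal.
From mathcomp Require Export topology normedtype.
Export numFieldNormedType.Exports.
Set Implicit Arguments.
Unset Strict Implicit.
Unset Printing Implicit Defensive.
Import Order.TTheory GRing.Theory Num.Theory.
Local Open Scope classical_set_scope.
Local Open Scope ring_scope.

(* Functions indexed by pairs of nodes (resp. by nodes) are only meaningful on
   arcs (resp. on depots, for [vstart] and [vend]). *)
Record instance (R : realType) (V : finType) := Instance {
  customers : {set V};
  depots : {set V};
  stations : {set V};
  nodes_cover : forall i, i \in customers :|: depots :|: stations;
  customers_depots : customers :&: depots = finset.set0;
  customers_stations : customers :&: stations = finset.set0;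
  depots_stations : depots :&: stations = finset.set0;

  arc : rel V;
  arc_irreflexive : irreflexive arc;
  travel_time : V -> V -> R;
  arc_cost : V -> V -> R;
  battery_use : V -> V -> R;
  travel_time_gt0 : forall i j, arc i j -> 0 < travel_time i j;
  arc_cost_gt0 : forall i j, arc i j -> 0 < arc_cost i j;
  battery_use_gt0 : forall i j, arc i j -> 0 < battery_use i j;

  horizon : R;
  battery : R;
  capacity : R;
  demand : V -> R;
  tw_open : V -> R;
  tw_close : V -> R;
  demand_ge0 : forall i, 0 <= demand i;
  time_window : forall i,
    [/\ 0 <= tw_open i, tw_open i <= tw_close i & tw_close i <= horizon];
  non_customer : forall i, i \in depots :|: stations ->
    [/\ demand i = 0, tw_open i = 0 & tw_close i = horizon];

  vstart : V -> nat;
  vend : V -> nat;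

  (* Values at negative times are irrelevant. *)
  charging : R -> R;
  charging_range : forall t, 0 <= t -> 0 <= charging t <= battery;
  charging0 : charging 0 = 0;
  charging_concave : forall s t l, 0 <= s -> 0 <= t -> 0 <= l <= 1 ->
    l * charging s + (1 - l) * charging t <= charging (l * s + (1 - l) * t);
  charging_nondecreasing : forall s t, 0 <= s -> s <= t ->
    charging s <= charging t;
  charging_continuous : {within `[0, +oo[, continuous charging};
  charging_increasing : forall s t, 0 <= s -> s < t ->
    charging s < battery -> charging s < charging t;
  charging_full : exists2 t, 0 <= t & charging t = battery
}.

Section Paths.
Context {R : realType} {V : finType} (I : instance R V).

(* The node sequence (n_0, ..., n_m) is coded by (n_0, [:: n_1; ...; n_m]). *)
Definition npath : Type := (V * seq V)%type.

Definition nodes (p : npath) : seq V := p.1 :: p.2.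
Definition plength (p : npath) : nat := size p.2.
Definition node (p : npath) (k : nat) : V := nth p.1 (nodes p) k.

Definition is_path (p : npath) : Prop :=
  [/\ node p 0 \in depots I,
      node p (plength p) \in depots I,
      forall k, (0 < k < plength p)%N ->
        node p k \in customers I :|: stations I
    & forall k, (k < plength p)%N -> arc I (node p k) (node p k.+1)].

(* The infimum is attained for b in [0, B], by continuity. *)
Definition charging_inv (b : R) : R :=
  inf [set t | 0 <= t /\ charging I t = b].

Definition charge (b t : R) : R := charging I (charging_inv b + t).

Fixpoint arrival (p : npath) (tau : nat -> R) (k : nat) : R :=
  if k is k'.+1 then
    Num.max (arrival p tau k' + tau k' + travel_time I (node p k') (node p k))
            (tw_open I (node p k))
  else 0.

Fixpoint battery_level (p : npath) (tau : nat -> R) (k : nat) : R :=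
  if k is k'.+1 then
    (if node p k' \in stations I then charge (battery_level p tau k') (tau k')
     else battery_level p tau k') - battery_use I (node p k') (node p k)
  else battery I.

Definition charging_times (p : npath) (tau : nat -> R) : Prop :=
  forall k, (k <= plength p)%N ->
    0 <= tau k /\ (node p k \notin stations I -> tau k = 0).

Definition feasible_path (p : npath) : Prop :=
  is_path p /\
  exists tau : nat -> R,
    [/\ charging_times p tau,
        \sum_(0 <= k < (plength p).+1) demand I (node p k) <= capacity I,
        forall k, (k <= plength p)%N ->
          0 <= battery_level p tau k <= battery I
      & forall k, (k <= plength p)%N ->
          tw_open I (node p k) <= arrival p tau k <= tw_close I (node p k)].

Definition path_cost (p : npath) : R :=
  \sum_(0 <= k < plength p) arc_cost I (node p k) (node p k.+1).

Definition visits (i : V) (p : npath) : nat := count_mem i (nodes p).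

Definition starts_at (j : V) (p : npath) : bool := node p 0 == j.
Definition ends_at (j : V) (p : npath) : bool := node p (plength p) == j.

Definition elementary_path (p : npath) : Prop :=
  feasible_path p /\ forall i, i \in customers I -> (visits i p <= 1)%N.

Definition P_elem : set npath := [set p | elementary_path p].

(* Travel times are bounded away from 0 and arrival times are at most the
   horizon, so the sums [\sum_(p \in P)] below are over finite sets. *)
Lemma feasible_paths_finite : finite_set [set p | feasible_path p].
Proof.
pose delta := \big[Num.min/1]_(a : V * V | arc I a.1 a.2)
  travel_time I a.1 a.2.
have delta_gt0 : 0 < delta.
  by apply: lt_bigmin => // a; exact: travel_time_gt0.
have arrival_ge p tau k : is_path p -> charging_times p tau ->
    (k <= plength p)%N -> k%:R * delta <= arrival p tau k.
  move=> [_ _ _ arcs] ct; elim: k => [|k IHk] km /=; first by rewrite mul0r.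
  rewrite le_max -natr1 mulrDl mul1r; apply/orP; left.
  apply: lerD.
    by rewrite -[leLHS]addr0 lerD ?IHk 1?ltnW//; case: (ct k (ltnW km)).
  exact: (bigmin_le_cond _ (j := (node p k, node p k.+1))
    (P := fun a => arc I a.1 a.2) _ (arcs k km)).
pose M := Num.truncn (horizon I / delta).
apply: (@sub_finite_set _ _
  ((fun a : V * M.-bseq V => (a.1, val a.2)) @` [set: V * M.-bseq V])); last first.
  exact/finite_image/finite_finset.
move=> [n0 s] [pp [tau [ct _ _ tw]]].
have sM : (size s <= M)%N.
  rewrite /M truncn_ge_nat; last first.
    have [h1 h2 h3] := time_window I n0.
    by rewrite divr_ge0 ?(ltW delta_gt0)// (le_trans h1)// (le_trans h2).
  rewrite ler_pdivlMr //.
  apply: le_trans (arrival_ge _ _ _ pp ct (leqnn _)) _.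
  have /andP[_ /le_trans] := tw _ (leqnn _); apply.
  by case: (time_window I (node (n0, s) (plength (n0, s)))).
by exists (n0, Bseq sM).
Qed.

Definition ng_neighborhood (N : V -> {set V}) : Prop :=
  [/\ forall i, i \in N i,
      forall i, i \in customers I -> N i \subset customers I
    & forall i, i \in depots I :|: stations I ->
        N i \subset i |: customers I].

Definition ng_feasible (N : V -> {set V}) (p : npath) : Prop :=
  forall j k, (j < k <= plength p)%N -> node p j = node p k ->
    exists2 l, (j < l < k)%N & node p j \notin N (node p l).

Definition P_ng (N : V -> {set V}) : set npath :=
  [set p | feasible_path p /\ ng_feasible N p].

End Paths.

Section Master.
Context {R : realType} {V : finType} (I : instance R V).

Definition src_set (S : {set V}) : Prop := S \subset customers I /\ #|S| = 3%N.

Definition src_coef (S : {set V}) (p : npath (V := V)) : R :=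
  (Num.floor (\sum_(i in S) 2^-1 * (visits i p)%:R : R))%:~R.

Definition src_rhs (S : {set V}) : R :=
  (Num.floor (\sum_(i in S) 2^-1 : R))%:~R.

(* A vector (z^p) indexed by P is coded by a function vanishing outside P. *)
Definition plan : Type := npath (V := V) -> R.

Definition src_satisfied (P : set npath) (z : plan) (S : {set V}) : Prop :=
  \sum_(p \in P) src_coef S p * z p <= src_rhs S.

Definition objective (P : set npath) (z : plan) : R :=
  \sum_(p \in P) path_cost I p * z p.

Definition linking_constraints (P : set npath) (z : plan) : Prop :=
  [/\ forall j, j \in depots I ->
        \sum_(p \in P) (starts_at j p)%:R * z p = (vstart I j)%:R,
      forall j, j \in depots I ->
        \sum_(p \in P) (ends_at j p)%:R * z p >= (vend I j)%:R
    & forall i, i \in customers I ->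
        \sum_(p \in P) (visits i p)%:R * z p = 1].

Definition lp_feasible (P : set npath) (Q : {set {set V}}) (z : plan) : Prop :=
  [/\ forall p, 0 <= z p,
      forall p, ~ P p -> z p = 0,
      linking_constraints P z
    & forall S, S \in Q -> src_satisfied P z S].

Definition lp_optimal (P : set npath) (Q : {set {set V}}) (z : plan) : Prop :=
  lp_feasible P Q z /\
  forall z', lp_feasible P Q z' -> objective P z <= objective P z'.

Definition ip_feasible (P : set npath) (z : plan) : Prop :=
  [/\ forall p, z p = 0 \/ z p = 1,
      forall p, ~ P p -> z p = 0
    & linking_constraints P z].

Definition ip_optimal (P : set npath) (z : plan) : Prop :=
  ip_feasible P z /\
  forall z', ip_feasible P z' -> objective P z <= objective P z'.

(* The value of an infeasible program is +oo. *)
Definition OPT_lp (P : set npath) : \bar R :=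
  ereal_inf [set (objective P z)%:E | z in lp_feasible P finset.set0].

Definition OPT_ip (P : set npath) : \bar R :=
  ereal_inf [set (objective P z)%:E | z in ip_feasible P].

Record duals := Duals {
  dual_start : V -> R;
  dual_end : V -> R;
  dual_visit : V -> R;
  dual_cut : {set V} -> R
}.

Definition reduced_cost (Q : {set {set V}}) (y : duals) (p : npath) : R :=
  path_cost I p
  - \sum_(j in depots I) (starts_at j p)%:R * dual_start y j
  - \sum_(j in depots I) (ends_at j p)%:R * dual_end y j
  - \sum_(i in customers I) (visits i p)%:R * dual_visit y i
  - \sum_(S in Q) src_coef S p * dual_cut y S.

Definition dual_objective (Q : {set {set V}}) (y : duals) : R :=
  \sum_(j in depots I) (vstart I j)%:R * dual_start y j
  + \sum_(j in depots I) (vend I j)%:R * dual_end y j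
  + \sum_(i in customers I) dual_visit y i
  + \sum_(S in Q) src_rhs S * dual_cut y S.

Definition dual_feasible (P : set npath) (Q : {set {set V}}) (y : duals) :
    Prop :=
  [/\ forall j, j \in depots I -> 0 <= dual_end y j,
      forall S, S \in Q -> dual_cut y S <= 0
    & forall p, P p -> 0 <= reduced_cost Q y p].

Definition dual_optimal (P : set npath) (Q : {set {set V}}) (y : duals) :
    Prop :=
  dual_feasible P Q y /\
  forall y', dual_feasible P Q y' -> dual_objective Q y' <= dual_objective Q y.

End Master.

Arguments plan : clear implicits.
Arguments duals : clear implicits.

Section Algorithm.
Context {R : realType} {V : finType} (I : instance R V).

(* [Step1 N Q P] is the beginning of Step 1 with initial path set P.  In
   [Pricing N Q P z y] the linear program restricted to the current path set P
   has been solved, with primal and dual solutions z and y.  The incumbent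
   zI is [None] when the integer program of Step 2 is infeasible. *)
Inductive state :=
| Step1 of (V -> {set V}) & {set {set V}} & set (npath (V := V))
| Pricing of (V -> {set V}) & {set {set V}} & set (npath (V := V))
    & plan R V & duals R V
| Step2 of (V -> {set V}) & {set {set V}} & set (npath (V := V)) & plan R V
| Step3 of (V -> {set V}) & {set {set V}} & set (npath (V := V)) & plan R V
    & option (plan R V)
| Returned of plan R V & R & option (plan R V) & \bar R.

Definition elementary_support (z : plan R V) : Prop :=
  forall p, z p != 0 -> elementary_path I p.

(* node l lies on a cycle (i, n_1, ..., n_m, i) of the node sequence of p *)
Definition on_cycle (p : npath (V := V)) (i n : V) : Prop :=
  exists j l k, [/\ (j < l < k)%N, (k <= plength p)%N,
    node p j = i, node p k = i & node p l = n].

Definition ng_update (N : V -> {set V}) (z : plan R V) : V -> {set V} :=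
  fun n => N n :|: [set i in customers I | `[< exists p,
    [/\ z p != 0, ~ elementary_path I p & on_cycle p i n] >]]%SET.

Definition incumbent (P : set npath) (zI : option (plan R V)) : Prop :=
  if zI is Some z then ip_optimal I P z else ~ exists z, ip_feasible I P z.

Definition incumbent_value (P : set npath) (zI : option (plan R V)) : \bar R :=
  if zI is Some z then (objective I P z)%:E else +oo%E.

(* [cuts] is true for Steps 1--5 and false for Steps 1--4 alone. *)
Inductive step (cuts : bool) : state -> state -> Prop :=
| StepInit N Q P z y :
    lp_optimal I P Q z -> dual_optimal I P Q y ->
    step cuts (Step1 N Q P) (Pricing N Q P z y)
| StepAddColumns N Q P z y A z' y' :
    A !=set0 -> A `<=` [set p | P_ng I N p /\ reduced_cost I Q y p < 0] ->
    lp_optimal I (P `|` A) Q z' -> dual_optimal I (P `|` A) Q y' ->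
    step cuts (Pricing N Q P z y) (Pricing N Q (P `|` A) z' y')
| StepPriced N Q P z y :
    (forall p, P_ng I N p -> 0 <= reduced_cost I Q y p) ->
    step cuts (Pricing N Q P z y) (Step2 N Q P z)
| StepHeuristic N Q P z zI :
    incumbent P zI ->
    step cuts (Step2 N Q P z) (Step3 N Q P z zI)
| StepReturn N Q P z zI :
    elementary_support z ->
    (cuts -> forall S, src_set I S -> src_satisfied P z S) ->
    step cuts (Step3 N Q P z zI)
      (Returned z (objective I P z) zI (incumbent_value P zI))
| StepElementarity N Q P z zI :
    ~ elementary_support z ->
    step cuts (Step3 N Q P z zI)
      (Step1 (ng_update N z) Q (P `&` P_ng I (ng_update N z)))
| StepIntegrality N Q P z zI S :
    cuts -> elementary_support z ->
    src_set I S -> ~ src_satisfied P z S ->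
    step cuts (Step3 N Q P z zI) (Step1 N (S |: Q) P).

(* A maximal run, finite or infinite; a finite one is extended by repeating its
   last state. *)
Definition execution (cuts : bool) (N0 : V -> {set V}) (P0 : set npath)
    (e : nat -> state) : Prop :=
  e 0%N = Step1 N0 finset.set0 P0 /\
  forall k, step cuts (e k) (e k.+1) \/
    (~ (exists s, step cuts (e k) s) /\ e k.+1 = e k).

Definition restricted_lps_feasible (e : nat -> state) : Prop :=
  forall k N Q P, e k = Step1 N Q P -> exists z, lp_feasible I P Q z.

End Algorithm.

(* Main.v *)
Require Import Defs.
From mathcomp Require Import finmap.
From mathcomp Require Import ring lra.
Local Open Scope classical_set_scope.
Local Open Scope ring_scope.
Set Implicit Arguments.
Unset Strict Implicit.
Unset Printing Implicit Defensive.
Import Order.TTheory GRing.Theory Num.Theory.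

(** The algorithm terminates because every outer iteration uses up a finite
    resource and every inner one adds a column.  A cycle closed at a customer i
    in an ng-feasible path has a node whose neighborhood misses i, so that the
    elementarity step strictly enlarges some neighborhood; a violated
    subset-row cut is not yet in Q, since z satisfies the cuts of Q; and a path
    of negative reduced cost is not yet a column, since the dual solution is
    feasible for the current columns.  There are finitely many feasible paths,
    hence [measure] decreases at every step ([measure_step]).  No state other
    than a returned one is stuck ([progress]): the linear programs have primal
    and dual optimal solutions as soon as they are feasible, because costs are
    nonnegative ([lp_dual_optimal_exist]), and integer programs over finitely
    many columns that are feasible have optimal solutions.

    The value is right because, by strong duality, a relaxation solution z that
    is priced out is optimal over the whole of P(N) ([priced_out_optimal]), and
    P(N) contains all feasible elementary paths as long as N is an ng-neighborhood
    ([P_elem_sub_ng]).  When z is supported on elementary paths, it is thus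
    optimal for the relaxation over elementary paths with the cuts of Q
    ([returned_value]).  Without cuts this is the claimed value.  With cuts the
    value can only be larger, and it does not exceed the integer optimum since
    subset-row cuts, being obtained by Chvatal-Gomory rounding, hold for
    integer solutions ([ip_lp_feasible]).

    Strong duality of linear programming is derived from Farkas' lemma, which
    is proved by induction on the number of linear forms. *)

(** * Farkas' lemma *)

Section Farkas.
Context {R : realFieldType} {E : lmodType R}.

Lemma scalarBZ (f : E -> R) : scalar f ->
  forall x a y, f (x - a *: y) = f x - a * f y.
Proof.
by move=> lf x a y; rewrite addrC -scaleNr lf mulNr addrC.
Qed.

(** A linear form that is nonpositive wherever the forms [A j], for [j] in [s],
    are all nonpositive is a nonnegative combination of them.  Bartl's argument:
    if some [x0] shows that the last form [A j0] cannot be dropped, apply the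
    induction hypothesis to the forms composed with the projection along [x0]
    onto the kernel of [A j0]. *)
Lemma farkas (J : eqType) (s : seq J) (A : J -> E -> R) (g : E -> R) :
  uniq s -> (forall j, scalar (A j)) -> scalar g ->
  (forall x, {in s, forall j, A j x <= 0} -> g x <= 0) ->
  exists2 l : J -> R, forall j, 0 <= l j &
    forall x, g x = \sum_(j <- s) l j * A j x.
Proof.
elim: s A g => [|j0 s IHs] A g.
  move=> _ _ lg g_le0; exists (fun=> 0) => // x; rewrite big_nil.
  (* A linear form bounded above on a line through 0 vanishes on it. *)
  have g_line r : g (x - r *: x) <= 0 by exact: g_le0.
  by have := g_line 0; have := g_line 2; rewrite !scalarBZ//; lra.
move=> /= /andP[j0s us] lA lg g_le0.
have notj0 j : j \in s -> (j == j0) = false.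
  by move=> js; apply: contraNF j0s => /eqP <-.
have [[x0 Ax0 gx0]|nx0] :=
    pselect (exists2 x, {in s, forall j, A j x <= 0} & 0 < g x); last first.
  have [x Ax|l l0 gE] := IHs A g us lA lg.
    by rewrite leNgt; apply/negP => gx; apply: nx0; exists x.
  exists (fun j => if j == j0 then 0 else l j) => [j|x].
    by case: ifP.
  rewrite big_cons eqxx mul0r add0r gE.
  by apply: eq_big_seq => j js; rewrite notj0.
have Aj0_gt0 : 0 < A j0 x0.
  rewrite ltNge; apply/negP => Aj0; have := gx0; rewrite ltNge g_le0//.
  by move=> j; rewrite inE => /predU1P[->//|/Ax0].
pose pr x := x - (A j0 x / A j0 x0) *: x0.
have prE f : scalar f -> forall x, f (pr x) = f x - A j0 x / A j0 x0 * f x0.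
  by move=> lf x; rewrite /pr scalarBZ.
have lpr f : scalar f -> scalar (f \o pr).
  move=> lf a u v; rewrite /= !prE// lf lA; field.
  exact: lt0r_neq0.
have [j||x Ax|l l0 gE] := IHs (fun j => A j \o pr) (g \o pr) us.
- exact: lpr.
- exact: lpr.
- apply: g_le0 => j; rewrite inE => /predU1P[->|/Ax//].
  by rewrite prE// divfK ?subrr// lt0r_neq0.
exists (fun j => if j == j0 then
    (g x0 - \sum_(j <- s) l j * A j x0) / A j0 x0 else l j) => [j|x].
  case: ifP => // _; rewrite divr_ge0 ?(ltW Aj0_gt0)// subr_ge0.
  apply: le_trans (ltW gx0); rewrite big_seq sumr_le0// => i si.
  by rewrite mulr_ge0_le0// Ax0.
rewrite big_cons eqxx.
under eq_big_seq => j js do rewrite notj0//.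
have /= := gE x; rewrite prE// => /eqP; rewrite subr_eq => /eqP ->.
under eq_bigr do rewrite prE// mulrBr mulrCA.
rewrite sumrB -mulr_sumr; field; exact: lt0r_neq0.
Qed.

End Farkas.

(** * Strong duality of linear programming *)

(** The program is: minimize [c z] subject to [z >= 0] and, for each row j,
    [a j z = b j] if [eqr j] and [a j z >= b j] otherwise. *)
Section Duality.
Context {R : realFieldType} {K J : finType}.
Variables (eqr : pred J) (a : J -> K -> R) (b : J -> R) (c : K -> R).

(** Feasibility for the primal program. *)
Definition canonical_primal (z : K -> R) :=
  (forall k, 0 <= z k) /\
  forall j, if eqr j then \sum_k a j k * z k = b j
            else b j <= \sum_k a j k * z k.

(** Feasibility for the dual program; multipliers of equality rows are free. *)
Definition canonical_dual (y : J -> R) :=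
  (forall j, ~~ eqr j -> 0 <= y j) /\
  forall k, \sum_j a j k * y j <= c k.

(** Farkas' lemma is applied to the self-dual system in (t, z, y) obtained by
    homogenizing primal feasibility, dual feasibility and [c z <= b y].  If it
    has a solution with [t > 0], dividing by t gives the two optimal solutions.
    Otherwise t is a nonnegative combination of the constraints.  Let s be the
    multiplier of [c z <= b y].  If [s > 0], the multipliers themselves form a
    point (s, w, u) at which the combination is nonpositive although [t = s];
    if [s = 0], the same happens at (1, z0, y0). *)
Lemma strong_duality (z0 : K -> R) (y0 : J -> R) :
  canonical_primal z0 -> canonical_dual y0 ->
  exists z y, [/\ canonical_primal z, canonical_dual y &
    \sum_k c k * z k <= \sum_j b j * y j].
Proof.
move=> [z0_ge0 az0] [y0_ge0 ay0].
pose E : lmodType R := (R^o * {ffun K -> R^o} * {ffun J -> R^o})%type.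
pose t (x : E) : R := x.1.1.
pose z (x : E) k : R := x.1.2 k.
pose y (x : E) j : R := x.2 j.
pose az x j := \sum_k a j k * z x k.
pose ay x k := \sum_j a j k * y x j.
pose cz x := \sum_k c k * z x k.
pose bys x := \sum_j b j * y x j.
(* The system asks that each of these forms be nonpositive. *)
pose A (i : K + J + (J + J) + (K + unit)) (x : E) : R := match i with
  | inl (inl (inl k)) => - z x k
  | inl (inl (inr j)) => if eqr j then 0 else - y x j
  | inl (inr (inl j)) => b j * t x - az x j
  | inl (inr (inr j)) => if eqr j then az x j - b j * t x else 0
  | inr (inl k) => ay x k - c k * t x
  | inr (inr _) => cz x - bys x
  end.
have lt : scalar t by [].
have lz k : scalar (z^~ k) by move=> r u v; rewrite /z/= !ffunE.
have ly j : scalar (y^~ j) by move=> r u v; rewrite /y/= !ffunE.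
have lsum (L : finType) (w : L -> R) (f : E -> L -> R) :
    (forall i, scalar (f^~ i)) -> scalar (fun x => \sum_i w i * f x i).
  move=> lf r u v; rewrite mulr_sumr -big_split/=; apply: eq_bigr => i _.
  by rewrite lf; ring.
have laz j : scalar (az^~ j) by exact: lsum.
have lay k : scalar (ay^~ k) by exact: lsum.
have lcz : scalar cz by exact: lsum.
have lby : scalar bys by exact: lsum.
have lA i : scalar (A i).
  case: i => [[[k|j]|[j|j]]|[k|[]]] r u v /=; try case: (eqr j);
    rewrite ?(lt, lz, ly, laz, lay, lcz, lby); ring.
have [[x Ax tx]|nx] := pselect (exists2 x, (forall i, A i x <= 0) & 0 < t x).
  exists (fun k => z x k / t x), (fun j => y x j / t x).
  have scale (L : finType) (w f : L -> R) :
      \sum_i w i * (f i / t x) = (\sum_i w i * f i) / t x.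
    by rewrite mulr_suml; apply: eq_bigr => i _; rewrite mulrA.
  split.
  - split=> [k|j].
      by have := Ax (inl (inl (inl k))); rewrite /= oppr_le0 => zk;
      rewrite divr_ge0 // ltW.
    rewrite scale.
    have /= := Ax (inl (inr (inl j))); rewrite subr_le0 -ler_pdivlMr// => h1.
    have /= := Ax (inl (inr (inr j))); case: (eqr j) => //.
    rewrite subr_le0 -ler_pdivrMr// => h2.
    by apply/eqP; rewrite eq_le h1 h2.
  - split=> [j jN|k].
      have /= := Ax (inl (inl (inr j))); rewrite (negbTE jN) oppr_le0 => yj.
      by rewrite divr_ge0 // ltW.
    rewrite scale ler_pdivrMr// -subr_le0; exact: (Ax (inr (inl k))).
  - rewrite !scale ler_pM2r ?invr_gt0// -subr_le0.
    exact: (Ax (inr (inr tt))).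
have [x Ax|l l0 tE] := farkas (index_enum_uniq _) lA lt.
  rewrite leNgt; apply/negP => tx; apply: nx; exists x => // i.
  by apply: Ax; rewrite mem_index_enum.
pose lk k := l (inl (inl (inl k))).
pose lj j := l (inl (inl (inr j))).
pose u j := l (inl (inr (inl j))) - (if eqr j then l (inl (inr (inr j))) else 0).
pose w k := l (inr (inl k)).
pose s := l (inr (inr tt)).
have tE' x : t x = - \sum_k lk k * z x k
    - \sum_j (if eqr j then 0 else lj j * y x j)
    + \sum_j u j * (b j * t x - az x j) + \sum_k w k * (ay x k - c k * t x)
    + s * (cz x - bys x).
  rewrite [LHS]tE !big_sumType/=.
  have -> : \sum_(i : unit) l (inr (inr i)) * (cz x - bys x)
      = s * (cz x - bys x).
    by rewrite (bigD1 tt)//= big1 ?addr0// => -[].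
  have -> : \sum_j u j * (b j * t x - az x j) =
      \sum_j l (inl (inr (inl j))) * (b j * t x - az x j) +
      \sum_j l (inl (inr (inr j))) * (if eqr j then az x j - b j * t x else 0).
    rewrite -big_split/=; apply: eq_bigr => j _; rewrite /u.
    by case: (eqr j); ring.
  rewrite -!sumrN !addrA; do 5 congr (_ + _).
    by apply: eq_bigr => k _; rewrite mulrN.
  apply: eq_bigr => j _; rewrite /lj.
  by case: (eqr j); ring.
pose x0 : E := (1, [ffun k => z0 k], [ffun j => y0 j]).
pose x1 : E := (s, [ffun k => w k], [ffun j => u j]).
have w_ge0 k : 0 <= w k by exact: l0.
have u_ge0 j : ~~ eqr j -> 0 <= u j.
  by rewrite /u => /negbTE ->; rewrite subr0; exact: l0.
have lk_ge0 k : 0 <= lk k by exact: l0.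
have lj_ge0 j : 0 <= lj j by exact: l0.
have nonneg x : (forall k, 0 <= z x k) -> (forall j, ~~ eqr j -> 0 <= y x j) ->
    0 <= \sum_k lk k * z x k /\
    0 <= \sum_j (if eqr j then 0 else lj j * y x j).
  move=> z_ge0 y_ge0; split; apply: sumr_ge0 => i _; first exact: mulr_ge0.
  by case: ifPn => // /y_ge0 yi; rewrite mulr_ge0.
have : 0 <= s by exact: l0.
rewrite le_eqVlt => /predU1P[s0|s_gt0]; [have := tE' x0|have := tE' x1].
  have [||P1 P2] := nonneg x0.
  - by move=> k; rewrite /z ffunE.
  - by move=> j; rewrite /y ffunE; exact: y0_ge0.
  have P3 : \sum_j u j * (b j * t x0 - az x0 j) <= 0.
    apply: sumr_le0 => j _; rewrite mulr1 /az.
    under eq_bigr do rewrite /z ffunE.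
    have := az0 j; case: ifPn => [_ ->|jN le_b]; first by rewrite subrr mulr0.
    by rewrite mulr_ge0_le0 ?u_ge0// subr_le0.
  have P4 : \sum_k w k * (ay x0 k - c k * t x0) <= 0.
    apply: sumr_le0 => k _; rewrite mulr1 /ay.
    under eq_bigr do rewrite /y ffunE.
    by rewrite mulr_ge0_le0// subr_le0.
  have -> : t x0 = 1 by [].
  by rewrite -s0; lra.
have [||P1 P2] := nonneg x1.
- by move=> k; rewrite /z ffunE.
- by move=> j; rewrite /y ffunE; exact: u_ge0.
have -> : \sum_j u j * (b j * t x1 - az x1 j) =
    s * bys x1 - \sum_j \sum_k u j * a j k * w k.
  rewrite mulr_sumr -sumrB; apply: eq_bigr => j _.
  rewrite /y ffunE mulrBr mulr_sumr; congr (_ - _).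
    by rewrite (_ : t x1 = s)//; ring.
  by apply: eq_bigr => k _; rewrite /z ffunE mulrA.
have -> : \sum_k w k * (ay x1 k - c k * t x1) =
    \sum_j \sum_k u j * a j k * w k - s * cz x1.
  rewrite exchange_big/= mulr_sumr -sumrB; apply: eq_bigr => k _.
  rewrite /z ffunE mulrBr mulr_sumr; congr (_ - _).
    by apply: eq_bigr => j _; rewrite /y ffunE; ring.
  by rewrite (_ : t x1 = s)//; ring.
have -> : t x1 = s by [].
lra.
Qed.

End Duality.

(** * Duality for the restricted master problem *)

Section Translation.
Context {R : realType} {V : finType} (I : instance R V).
Local Notation path := (npath (V := V)).
Implicit Types (P : set path) (Q : {set {set V}}) (z : plan R V) (y : duals R V).

(** The rows of the master problem: departures from and arrivals at each depot,
    visits to each customer, and cuts.  The coefficients are zero on the rows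
    whose node is not a depot (resp. not a customer), or whose set is not in Q;
    cuts are negated, so as to read as lower bounds. *)
Local Notation lp_row := (V + V + V + {set V})%type.

Definition row_coef Q (r : lp_row) (p : path) : R :=
  match r with
  | inl (inl (inl j)) => (j \in depots I)%:R * (starts_at j p)%:R
  | inl (inl (inr j)) => (j \in depots I)%:R * (ends_at j p)%:R
  | inl (inr i) => (i \in customers I)%:R * (visits i p)%:R
  | inr X => - ((X \in Q)%:R * src_coef X p)
  end.

Definition row_rhs Q (r : lp_row) : R :=
  match r with
  | inl (inl (inl j)) => (j \in depots I)%:R * (vstart I j)%:R
  | inl (inl (inr j)) => (j \in depots I)%:R * (vend I j)%:R
  | inl (inr i) => (i \in customers I)%:R
  | inr X => - ((X \in Q)%:R * src_rhs X)
  end.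

(** The rows that are equalities. *)
Definition row_eq (r : lp_row) : bool :=
  match r with inl (inl (inr _)) | inr _ => false | _ => true end.

(** The dual variables, as one multiplier per row; those of the cuts are
    nonpositive, whence the sign. *)
Definition multiplier y (r : lp_row) : R :=
  match r with
  | inl (inl (inl j)) => dual_start y j
  | inl (inl (inr j)) => dual_end y j
  | inl (inr i) => dual_visit y i
  | inr X => - dual_cut y X
  end.

(** The inverse of [multiplier]. *)
Definition duals_of (u : lp_row -> R) : duals R V :=
  Duals (fun j => u (inl (inl (inl j)))) (fun j => u (inl (inl (inr j))))
    (fun i => u (inl (inr i))) (fun S => - u (inr S)).

Lemma duals_ofK u : multiplier (duals_of u) =1 u.
Proof. by move=> [[[j|j]|i]|S] //=; rewrite opprK. Qed.

Lemma sum_in (T : finType) (A : {set T}) (F : T -> R) :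
  \sum_(i in A) F i = \sum_i (i \in A)%:R * F i.
Proof.
by rewrite big_mkcond; apply: eq_bigr => i _; case: ifP; rewrite ?mul1r ?mul0r.
Qed.

Lemma reduced_costE Q y p : reduced_cost I Q y p =
  path_cost I p - \sum_r row_coef Q r p * multiplier y r.
Proof.
rewrite /reduced_cost !sum_in !big_sumType/= !opprD !addrA.
congr (_ - _ - _ - _ - _); apply: eq_bigr => i _; rewrite ?mulrA//.
by rewrite mulrNN.
Qed.

Lemma dual_objectiveE Q y :
  dual_objective I Q y = \sum_r row_rhs Q r * multiplier y r.
Proof.
rewrite /dual_objective !sum_in !big_sumType/=.
congr (_ + _ + _ + _); apply: eq_bigr => i _; rewrite ?mulrA//.
by rewrite mulrNN.
Qed.

Lemma fsum_fset (T : choiceType) (A : set T) (F : T -> R) : finite_set A ->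
  \sum_(p \in A) F p = \sum_(p <- fset_set A) F p.
Proof. by move=> finA; rewrite fsbig_finite. Qed.

Lemma lp_feasibleE P Q z : finite_set P -> lp_feasible I P Q z <->
  [/\ forall p, 0 <= z p,
      forall p, ~ P p -> z p = 0 &
      forall r, let lhs := \sum_(p <- fset_set P) row_coef Q r p * z p in
        if row_eq r then lhs = row_rhs Q r else row_rhs Q r <= lhs].
Proof.
move=> finP.
have scale b (f : path -> R) :
    \sum_(p <- fset_set P) b%:R * f p * z p =
    b%:R * \sum_(p \in P) f p * z p.
  by rewrite fsum_fset// mulr_sumr; apply: eq_bigr => p _; rewrite mulrA.
have scaleN b (f : path -> R) :
    \sum_(p <- fset_set P) - (b%:R * f p) * z p =
    - (b%:R * \sum_(p \in P) f p * z p).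
  by rewrite -scale -sumrN; apply: eq_bigr => p _; rewrite mulNr.
split=> [[z0 zP [zs ze zv] zc]|[z0 zP zr]]; split=> //.
- move=> [[[j|j]|i]|S] /=; rewrite ?scale ?scaleN.
  + by case: (boolP (j \in _)) => [/zs->//|]; rewrite !mul0r.
  + by case: (boolP (j \in _)) => [/ze|]; rewrite ?mul1r// !mul0r.
  + by case: (boolP (i \in _)) => [/zv->|]; rewrite ?mulr1// !mul0r.
  + by rewrite lerN2; case: (boolP (S \in _)) => [/zc|]; rewrite ?mul1r// !mul0r.
- split=> [j jD|j jD|i iC].
  + by have /= := zr (inl (inl (inl j))); rewrite scale jD !mul1r.
  + by have /= := zr (inl (inl (inr j))); rewrite scale jD !mul1r.
  + by have /= := zr (inl (inr i)); rewrite scale iC mul1r.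
- move=> S SQ.
  by have /= := zr (inr S); rewrite scaleN SQ !mul1r lerN2.
Qed.

(** The gap is the sum of the reduced costs weighted by z and of the slacks
    weighted by the multipliers. *)
Lemma weak_duality P Q z y : finite_set P ->
  lp_feasible I P Q z -> dual_feasible I P Q y ->
  dual_objective I Q y <= objective I P z.
Proof.
move=> finP /(lp_feasibleE _ _ finP)[z0 zP zr] [ye yc yr].
rewrite dual_objectiveE /objective fsum_fset//.
have : 0 <= \sum_(p <- fset_set P) reduced_cost I Q y p * z p.
  rewrite big_seq sumr_ge0// => p; rewrite in_fset_set// in_setE => Pp.
  by rewrite mulr_ge0// yr.
have : 0 <= \sum_r multiplier y r *
    (\sum_(p <- fset_set P) row_coef Q r p * z p - row_rhs Q r).
  apply: sumr_ge0 => r _; have := zr r.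
  case: r => [[[j|j]|i]|S] /=; try by move=> ->; rewrite subrr mulr0.
  - case: (boolP (j \in _)) => [/ye yj|_ _].
      by move=> h; rewrite mulr_ge0// subr_ge0.
    rewrite big1 ?mul0r ?subrr ?mulr0// => p _.
    by rewrite !mul0r.
  - case: (boolP (S \in _)) => [/yc yS|_ _].
      by move=> h; rewrite mulr_ge0 ?oppr_ge0// subr_ge0.
    by rewrite big1 => [|p _]; rewrite !mul0r !oppr0 ?mul0r// addr0 mulr0.
under eq_bigr do rewrite mulrBr mulr_sumr.
rewrite sumrB exchange_big/=.
under [X in _ -> 0 <= X -> _]eq_bigr do rewrite reduced_costE mulrBl.
rewrite sumrB.
have -> : \sum_(p <- fset_set P) (\sum_r row_coef Q r p * multiplier y r) * z p =
    \sum_(p <- fset_set P) \sum_r multiplier y r * (row_coef Q r p * z p).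
  apply: eq_bigr => p _; rewrite mulr_suml.
  by apply: eq_bigr => r _; ring.
under [X in _ -> _ -> X <= _]eq_bigr do rewrite mulrC.
lra.
Qed.

Lemma path_cost_ge0 p : is_path I p -> 0 <= path_cost I p.
Proof.
move=> [_ _ _ arcs]; rewrite /path_cost big_nat_cond sumr_ge0// => k.
by rewrite andbT => /andP[_ /arcs ?]; exact/ltW/arc_cost_gt0.
Qed.

(** Costs are nonnegative, so that 0 is dual feasible and primal feasibility is
    enough. *)
Lemma lp_strong_duality P Q z0 : P `<=` [set p | feasible_path I p] ->
  lp_feasible I P Q z0 ->
  exists z y, [/\ lp_feasible I P Q z, dual_feasible I P Q y &
    objective I P z <= dual_objective I Q y].
Proof.
move=> PF; have finP := sub_finite_set PF (feasible_paths_finite I).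
move=> /(lp_feasibleE _ _ finP)[z0_ge0 z0P z0r].
have PfsetP (k : fset_set P) : P (val k).
  by have := valP k; rewrite in_fset_set// in_setE.
pose c (k : fset_set P) := path_cost I (val k).
pose a r (k : fset_set P) := row_coef Q r (val k).
have [||z [u [[z_ge0 zr] [u_ge0 ur] zu]]] :=
    strong_duality (eqr := row_eq) (a := a) (b := row_rhs Q) (c := c)
      (z0 := fun k => z0 (val k)) (y0 := fun=> 0).
- split=> // r; have := z0r r.
  by rewrite (big_seq_fsetE _ _ xpredT (fun p => row_coef Q r p * z0 p)).
- split=> // k; rewrite big1 => [|j _]; last by rewrite mulr0.
  by apply: path_cost_ge0; have [] := PF _ (PfsetP k).
pose zp p := oapp z 0 (insub p).
have zpE k : zp (val k) = z k by rewrite /zp valK.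
exists zp, (duals_of u); split.
- apply/(lp_feasibleE _ _ finP); split.
  + by move=> p; rewrite /zp; case: insubP => //=.
  + move=> p nPp; rewrite /zp insubN//.
    by apply: contra_notN nPp; rewrite in_fset_set// in_setE.
  + move=> r /=; have := zr r.
    rewrite (big_seq_fsetE _ _ xpredT (fun p => row_coef Q r p * zp p))/=.
    by under [in X in _ -> X]eq_bigr do rewrite zpE.
- split=> [j jD|S SQ|p Pp] /=.
  + exact: u_ge0.
  + by rewrite oppr_le0 u_ge0.
  + have pP : p \in fset_set P by rewrite in_fset_set// in_setE.
    rewrite reduced_costE subr_ge0; have := ur [` pP]%fset.
    by under [in X in _ -> X]eq_bigr do rewrite duals_ofK.
- rewrite dual_objectiveE /objective fsum_fset//.
  rewrite (big_seq_fsetE _ _ xpredT (fun p => path_cost I p * zp p))/=.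
  under eq_bigr do rewrite zpE.
  by under [X in _ <= X]eq_bigr do rewrite duals_ofK.
Qed.

End Translation.

(** * Optimal solutions of the master problem *)

Section Optima.
Context {R : realType} {V : finType} (I : instance R V).
Local Notation path := (npath (V := V)).
Implicit Types (P : set path) (Q : {set {set V}}) (z : plan R V) (y : duals R V).

Lemma lp_dual_optimal_exist P Q z0 : P `<=` [set p | feasible_path I p] ->
  lp_feasible I P Q z0 ->
  exists z y, lp_optimal I P Q z /\ dual_optimal I P Q y.
Proof.
move=> PF fz0; have finP := sub_finite_set PF (feasible_paths_finite I).
have [z [y [fz fy zy]]] := lp_strong_duality PF fz0.
exists z, y; split; [split=> // z' fz'|split=> // y' fy'].
- exact: le_trans zy (weak_duality finP fz' fy).
- exact: le_trans (weak_duality finP fz fy') zy.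
Qed.

Lemma optimal_duality_gap P Q z y : P `<=` [set p | feasible_path I p] ->
  lp_optimal I P Q z -> dual_optimal I P Q y ->
  objective I P z <= dual_objective I Q y.
Proof.
move=> PF [fz oz] [fy oy].
have [z' [y' [fz' fy' zy]]] := lp_strong_duality PF fz.
by rewrite (le_trans (oz _ fz'))// (le_trans zy)// oy.
Qed.

(** A plan supported on P may be seen as a plan over any larger set P'. *)
Section Widening.
Variables (P P' : set path) (z : plan R V).
Hypotheses (PP' : P `<=` P') (zP : forall p, ~ P p -> z p = 0).

Lemma fsum_widen (f : path -> R) :
  \sum_(p \in P') f p * z p = \sum_(p \in P) f p * z p.
Proof.
by symmetry; apply: fsbig_widen => // p [_ nPp]; rewrite /= zP// mulr0.
Qed.

Lemma objective_widen : objective I P' z = objective I P z.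
Proof. exact: fsum_widen. Qed.

Lemma src_satisfied_widen S : src_satisfied P' z S <-> src_satisfied P z S.
Proof. by rewrite /src_satisfied fsum_widen. Qed.

Lemma linking_widen : linking_constraints I P' z <-> linking_constraints I P z.
Proof.
by split=> -[zs ze zv]; split=> [j /zs|j /ze|j /zv]; rewrite fsum_widen.
Qed.

Lemma lp_feasible_widen Q : lp_feasible I P' Q z <-> lp_feasible I P Q z.
Proof.
split=> -[z0 zP0 /linking_widen zl zc]; split=> //.
- by move=> S /zc /src_satisfied_widen.
- by move=> p nP'p; apply: zP => /PP'.
- by move=> S /zc; rewrite src_satisfied_widen.
Qed.

End Widening.

Lemma lp_feasible_no_cuts P Q z :
  lp_feasible I P Q z -> lp_feasible I P finset.set0 z.
Proof. by move=> [? ? ? _]; split=> // S; rewrite finset.inE. Qed.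

(** The stopping criterion of column generation: the dual solution of the
    restricted program is then feasible for the full one, and certifies z. *)
Lemma priced_out_optimal P P' Q z y :
  P `<=` P' -> P' `<=` [set p | feasible_path I p] ->
  lp_optimal I P Q z -> dual_optimal I P Q y ->
  (forall p, P' p -> 0 <= reduced_cost I Q y p) ->
  lp_optimal I P' Q z.
Proof.
move=> PP' P'F oz oy y_ge0.
have zP : forall p, ~ P p -> z p = 0 by case: oz => -[].
have fz : lp_feasible I P' Q z.
  by apply/(lp_feasible_widen PP' zP); case: oz.
split=> // z' fz'; rewrite (objective_widen PP' zP).
apply: le_trans (optimal_duality_gap (subset_trans PP' P'F) oz oy) _.
apply: weak_duality fz' _.
  exact: sub_finite_set P'F (feasible_paths_finite I).
by case: oy => -[? ? _] _; split.
Qed.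

Lemma ip_optimal_exists P z0 : finite_set P ->
  ip_feasible I P z0 -> exists z, ip_optimal I P z.
Proof.
move=> finP.
(* Binary plans over P are the indicators of the finitely many subsets of P. *)
pose ind (B : {set fset_set P}) : plan R V :=
  fun p => if insub p is Some k then (k \in B)%:R else 0.
have indE z : ip_feasible I P z -> z = ind [set k | z (val k) == 1]%SET.
  move=> [z01 zP _]; apply/funext => p; rewrite /ind; case: insubP => [k _ <-|].
    by rewrite finset.inE; case: (z01 (val k)) => ->; rewrite ?eqxx// eq_sym oner_eq0.
  by rewrite in_fset_set// => /negP; rewrite in_setE => /zP.
move=> fz0; pose B0 := [set k : fset_set P | z0 (val k) == 1]%SET.
have FB0 : `[< ip_feasible I P (ind B0) >] by apply/asboolP; rewrite -indE.
case: (arg_minP (P := fun B => `[< ip_feasible I P (ind B) >])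
  (fun B => objective I P (ind B)) FB0) => B /asboolP fB minB.
exists (ind B); split=> // z fz; rewrite (indE _ fz); apply: minB.
by apply/asboolP; rewrite -indE.
Qed.

(** Integer solutions satisfy the subset-row cuts: the left-hand side of a cut
    is an integer, and at most the combination with weights 1/2 of the
    partitioning constraints of S, whose right-hand side is rounded down. *)
Lemma ip_lp_feasible P Q z : finite_set P ->
  {in Q, forall S, src_set I S} -> ip_feasible I P z -> lp_feasible I P Q z.
Proof.
move=> finP srcQ [z01 zP zl].
have z_ge0 p : 0 <= z p by case: (z01 p) => ->.
split=> // S /srcQ [SC _].
have zint p : z p \is a Num.int by case: (z01 p) => ->.
rewrite /src_satisfied /src_rhs /src_coef fsum_fset//.
set lhs := \sum_(p <- _) _.
have /floorK <- : lhs \is a Num.int.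
  by apply: rpred_sum => p _; rewrite rpredM// intr_int.
rewrite ler_int; apply: le_floor.
case: zl => _ _ zv.
apply: (@le_trans _ _ (\sum_(p <- fset_set P)
    (\sum_(i in S) 2^-1 * (visits i p)%:R) * z p)).
  by apply: ler_sum => p _; rewrite ler_wpM2r// Num.Theory.floor_le.
under eq_bigr do rewrite mulr_suml.
rewrite exchange_big/=; apply: ler_sum => i iS.
under eq_bigr do rewrite -mulrA.
by rewrite -mulr_sumr -fsum_fset// zv ?mulr1// (fintype.subsetP SC).
Qed.

End Optima.

(** * ng-neighborhoods *)

Section Neighborhoods.
Context {R : realType} {V : finType} (I : instance R V).
Local Notation path := (npath (V := V)).
Implicit Types (N : V -> {set V}) (p : path).

Lemma count_mem_gt1P (T : eqType) (x0 x : T) (s : seq T) :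
  (1 < count_mem x s)%N <->
  exists j k, [/\ (j < k < size s)%N, nth x0 s j = x & nth x0 s k = x].
Proof.
elim: s => [|a s IHs] /=; first by split=> // -[j [k [/andP[]]]].
split.
  case: (eqVneq a x) => [->|_] /=.
    rewrite add1n ltnS -has_count has_pred1 => xs.
    by exists 0%N, (index x s).+1; rewrite /= ltnS index_mem nth_index.
  by rewrite add0n => /IHs[j [k [jk jx kx]]]; exists j.+1, k.+1.
move=> [[|j] [[|k] [//= jk jx kx]]].
  by rewrite jx eqxx add1n ltnS -has_count has_pred1 -kx mem_nth.
by apply: leq_trans (leq_addl _ _); apply/IHs; exists j, k.
Qed.

Lemma visits_gt1P i p : (1 < visits i p)%N <->
  exists j k, [/\ (j < k <= plength p)%N, node p j = i & node p k = i].
Proof. exact: count_mem_gt1P. Qed.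

(** An elementary path may still visit a station twice, and end at the depot it
    starts from.  The node that follows the first of two visits is a different
    node, and its neighborhood contains no depot or station but itself. *)
Lemma elementary_ng_feasible N p :
  ng_neighborhood I N -> elementary_path I p -> ng_feasible N p.
Proof.
move=> [_ Ncust Nother] [[[_ _ _ p_arc] _] p1] j k /[dup] jkm /andP[jk km] ejk.
have [iC|iC] := boolP (node p j \in customers I).
  have := p1 _ iC; rewrite leqNgt => /negP[].
  by apply/visits_gt1P; exists j, k.
have adj : node p j.+1 != node p j.
  have := p_arc j (leq_trans jk km); apply: contraTneq => ->.
  by rewrite arc_irreflexive.
exists j.+1.
  rewrite ltnSn/= ltn_neqAle jk andbT; apply: contraNneq adj => ->.
  by rewrite ejk.
have [sC|sC] := boolP (node p j.+1 \in customers I).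
  by apply: contra iC; exact: (fintype.subsetP (Ncust _ sC)).
have sDS : node p j.+1 \in depots I :|: stations I.
  have := nodes_cover I (node p j.+1).
  by rewrite !finset.in_setU (negbTE sC).
apply: contra iC => /(fintype.subsetP (Nother _ sDS)).
by rewrite finset.in_setU1 eq_sym (negbTE adj).
Qed.

Lemma P_elem_sub_ng N : ng_neighborhood I N -> P_elem I `<=` P_ng I N.
Proof.
by move=> ngN p ep; split; [case: ep|exact: elementary_ng_feasible].
Qed.

Lemma P_ng_feasible N : P_ng I N `<=` [set p | feasible_path I p].
Proof. by move=> p []. Qed.

Lemma ng_update_neighborhood N z :
  ng_neighborhood I N -> ng_neighborhood I (ng_update I N z).
Proof.
move=> [Nrefl Ncust Nother]; split=> [i|i iC|i iDS].
- by rewrite finset.in_setU Nrefl.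
- rewrite finset.subUset Ncust//=.
  by apply/fintype.subsetP => j; rewrite finset.inE => /andP[].
- rewrite finset.subUset Nother//=.
  apply/fintype.subsetP => j; rewrite finset.inE => /andP[jC _].
  by rewrite finset.in_setU1 jC orbT.
Qed.

(** A non-elementary path visits some customer i twice; by ng-feasibility, a
    node of the cycle so closed has a neighborhood missing i, to which the update
    adds i. *)
Lemma ng_update_strict N z : (forall p, z p != 0 -> P_ng I N p) ->
  ~ elementary_support I z ->
  exists i n, i \in ng_update I N z n /\ i \notin N n.
Proof.
move=> zN /existsNP[p /not_implyP[zp np]]; have [fp ngp] := zN _ zp.
have /existsNP[i /not_implyP[iC /negP]] :
    ~ forall i, i \in customers I -> (visits i p <= 1)%N.
  by move=> p1; apply: np.
rewrite -ltnNge => /visits_gt1P[j [k [jk ji ki]]].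
have [|l jlk lN] := ngp j k jk; first by rewrite ki.
exists i, (node p l); split; last by rewrite -ji.
rewrite finset.in_setU finset.inE iC/=; apply/orP; right.
apply/asboolP; exists p; split=> //.
by exists j, l, k; split=> //; case/andP: jk.
Qed.

End Neighborhoods.

(** * Termination and value of the algorithm *)

Section Termination.
Context {R : realType} {V : finType} (I : instance R V) (cuts : bool).
Local Notation path := (npath (V := V)).
Implicit Types (N : V -> {set V}) (P : set path) (Q : {set {set V}})
  (z : plan R V) (s : state (R := R) (V := V)).

(** What holds of the neighborhoods, cuts and columns throughout a run. *)
Definition sound N Q P : Prop :=
  [/\ ng_neighborhood I N, P `<=` P_ng I N,
      {in Q, forall S, src_set I S} & ~~ cuts -> Q = finset.set0].

(** What holds of the states of a run; after pricing, z is optimal over all of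
    P(N), and returned values satisfy the announced bounds. *)
Definition invariant s : Prop :=
  match s with
  | Step1 N Q P => sound N Q P
  | Pricing N Q P z y =>
      [/\ sound N Q P, lp_optimal I P Q z & dual_optimal I P Q y]
  | Step2 N Q P z | Step3 N Q P z _ =>
      [/\ sound N Q P, lp_feasible I P Q z & lp_optimal I (P_ng I N) Q z]
  | Returned z v _ _ =>
      (OPT_lp I (P_elem I) <= v%:E <= OPT_ip I (P_elem I))%E /\
      (~~ cuts -> v%:E = OPT_lp I (P_elem I))
  end.

Lemma sound_feasible N Q P :
  sound N Q P -> P `<=` [set p | feasible_path I p].
Proof. by case=> _ PN _ _ p /PN[]. Qed.

(** As z vanishes outside the elementary paths, which all belong to P(N), its
    optimality over P(N) restricts to them. *)
Lemma returned_value N Q P z : sound N Q P ->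
  lp_feasible I P Q z -> lp_optimal I (P_ng I N) Q z ->
  elementary_support I z ->
  (OPT_lp I (P_elem I) <= (objective I P z)%:E <= OPT_ip I (P_elem I))%E /\
  (~~ cuts -> (objective I P z)%:E = OPT_lp I (P_elem I)).
Proof.
move=> [ngN PN srcQ noQ] [_ zP _ _] [fz oz] ez.
have EN := P_elem_sub_ng ngN.
have zE p : ~ P_elem I p -> z p = 0.
  by move=> nep; apply: contra_notP nep => /eqP; exact: ez.
have fzE : lp_feasible I (P_elem I) Q z by apply/(lp_feasible_widen _ EN zE).
rewrite -(objective_widen I PN zP) (objective_widen I EN zE).
have lb z' : lp_feasible I (P_elem I) Q z' ->
    objective I (P_elem I) z <= objective I (P_elem I) z'.
  move=> fz'; have zE' : forall p, ~ P_elem I p -> z' p = 0 by case: fz'.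
  rewrite -(objective_widen I EN zE) -(objective_widen I EN zE').
  by apply: oz; apply/(lp_feasible_widen _ EN zE').
have le_lp : (OPT_lp I (P_elem I) <= (objective I (P_elem I) z)%:E)%E.
  apply: ge_ereal_inf; exists (objective I (P_elem I) z)%:E => //.
  by exists z => //; exact: lp_feasible_no_cuts fzE.
split.
  rewrite le_lp; apply/ereal_infP => _ [z' fz' <-]; rewrite lee_fin.
  apply/lb/ip_lp_feasible => //.
  apply: sub_finite_set (feasible_paths_finite I).
  exact: subset_trans EN (@P_ng_feasible _ _ _ _).
move=> /noQ Q0; apply/le_anti; rewrite le_lp andbT.
by apply/ereal_infP => _ [z' fz' <-]; rewrite lee_fin; apply: lb; rewrite Q0.
Qed.

Lemma invariant_step s s' : invariant s -> step I cuts s s' -> invariant s'.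
Proof.
move=> inv st; case: st inv => {s s'}.
- by move=> N Q P z y oz oy sd.
- move=> N Q P z y A z' y' _ AN oz' oy' [[ngN PN srcQ noQ] _ _].
  by split=> //; split=> // p [/PN|/AN[]].
- move=> N Q P z y y_ge0 [sd oz oy]; split=> //; first by case: oz.
  apply: priced_out_optimal oz oy _ => //; last exact: P_ng_feasible.
  by case: sd.
- by move=> N Q P z zI _.
- by move=> N Q P z zI ez _ [sd fz oz]; exact: returned_value oz ez.
- move=> N Q P z zI _ [[ngN PN srcQ noQ] _ _]; split=> //.
  exact: ng_update_neighborhood.
- move=> N Q P z zI S cutsT _ srcS _ [[ngN PN srcQ noQ] _ _]; split=> //.
    by move=> S'; rewrite finset.in_setU1 => /predU1P[->|/srcQ].
  by rewrite cutsT.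
Qed.

Lemma progress s : invariant s ->
  (forall N Q P, s = Step1 N Q P -> exists z, lp_feasible I P Q z) ->
  (exists s', step I cuts s s') \/
  exists z v zI vI, s = Returned z v zI vI.
Proof.
case: s => [N Q P|N Q P z y|N Q P z|N Q P z zI|z v zI vI] inv feas; last first.
- by right; exists z, v, zI, vI.
- left; have [ez|nez] := pselect (elementary_support I z); last first.
    by eexists; exact: StepElementarity.
  have [[cutsT nsrc]|ok] :=
      pselect (cuts /\ ~ forall S, src_set I S -> src_satisfied P z S).
    have /existsNP[S /not_implyP[srcS vS]] := nsrc.
    by eexists; exact: StepIntegrality srcS vS.
  eexists; apply: StepReturn => // cutsT.
  by apply: contrapT => nsrc; apply: ok.
- left; have [[z0 fz0]|no] := pselect (exists z, ip_feasible I P z); last first.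
    by exists (Step3 N Q P z None); exact: StepHeuristic.
  case: inv => /sound_feasible PF _ _.
  have finP := sub_finite_set PF (feasible_paths_finite I).
  have [z1 oz1] := ip_optimal_exists finP fz0.
  by exists (Step3 N Q P z (Some z1)); exact: StepHeuristic.
- left; case: inv => -[ngN PN srcQ noQ] [fz _] _.
  have [y_ge0|] :=
      pselect (forall p, P_ng I N p -> 0 <= reduced_cost I Q y p).
    by eexists; exact: StepPriced.
  move=> /existsNP[p /not_implyP[pN /negP]]; rewrite -ltNge => yp.
  have [||z' [y' [oz' oy']]] := @lp_dual_optimal_exist _ _ I (P `|` [set p]) Q z.
  + by move=> q [/PN[]|->] //; case: pN.
  + have zP : forall q, ~ P q -> z q = 0 by case: fz.
    exact/(lp_feasible_widen _ (@subsetUl _ P [set p]) zP).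
  exists (Pricing N Q (P `|` [set p]) z' y'); apply: StepAddColumns oz' oy'.
  + by exists p.
  + by move=> q ->.
- left; have [z0 fz0] := feas _ _ _ erefl.
  have [z [y [oz oy]]] := lp_dual_optimal_exist (sound_feasible inv) fz0.
  by eexists; exact: StepInit oz oy.
Qed.

(** How many times the neighborhoods and the cut set can still be enlarged. *)
Definition unused_room N Q : nat := \sum_n #|~: N n| + #|~: Q|.

(** The number of feasible paths. *)
Definition feasible_count : nat :=
  #|` fset_set [set p : path | feasible_path I p] |.

(** The number of feasible paths that are not columns yet. *)
Definition columns_left P : nat :=
  #|` fset_set ([set p : path | feasible_path I p] `\` P)|.

(** Decreases lexicographically: first the room for enlargement, then the
    position within an iteration, where the pricing loop is ranked by the number
    of columns left.  The factor exceeds the largest position by one. *)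
Definition measure s : nat :=
  match s with
  | Step1 N Q _ => unused_room N Q * feasible_count.+4.+1 + feasible_count.+4
  | Pricing N Q P _ _ =>
      unused_room N Q * feasible_count.+4.+1 + (columns_left P).+3
  | Step2 N Q _ _ => unused_room N Q * feasible_count.+4.+1 + 2
  | Step3 N Q _ _ _ => unused_room N Q * feasible_count.+4.+1 + 1
  | Returned _ _ _ _ => 0
  end.

Lemma finite_columns_left P :
  finite_set ([set p : path | feasible_path I p] `\` P).
Proof.
apply: sub_finite_set (feasible_paths_finite I); exact: subDsetl.
Qed.

Lemma columns_left_le P : (columns_left P <= feasible_count)%N.
Proof.
apply: fsubset_leq_card; rewrite -fset_set_sub//.
- exact: finite_columns_left.
- exact: feasible_paths_finite.
Qed.

Lemma columns_left_lt P P' p : P `<=` P' -> feasible_path I p ->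
  ~ P p -> P' p -> (columns_left P' < columns_left P)%N.
Proof.
move=> PP' fp nPp P'p; apply: fproper_ltn_card.
have finl := finite_columns_left.
rewrite fproperE; apply/andP; split.
  by rewrite -fset_set_sub//; exact: setDS.
apply/negP; rewrite -fset_set_sub// => sub.
by have [] := sub p (conj fp nPp).
Qed.

Lemma unused_room_ng N z Q i n :
  i \in ng_update I N z n -> i \notin N n ->
  (unused_room (ng_update I N z) Q < unused_room N Q)%N.
Proof.
move=> iN' iN; rewrite /unused_room ltn_add2r.
rewrite (bigD1 n)//= [ltnRHS](bigD1 n)//= -addSn leq_add//.
  apply: proper_card; apply/properP; split.
    by rewrite finset.setCS finset.subsetUl.
  by exists i; rewrite !finset.in_setC// iN'.
by apply: leq_sum => m _; apply: subset_leq_card; rewrite finset.setCS finset.subsetUl.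
Qed.

Lemma unused_room_cut N Q S :
  S \notin Q -> (unused_room N (S |: Q)%SET < unused_room N Q)%N.
Proof.
move=> SQ; rewrite /unused_room ltn_add2l; apply: proper_card.
apply/properP; split; first by rewrite finset.setCS finset.subsetUr.
by exists S; rewrite !finset.in_setC// finset.setU11.
Qed.

Lemma measure_step s s' :
  invariant s -> step I cuts s s' -> (measure s' < measure s)%N.
Proof.
have next_iteration a b c : (a < b)%N -> (a * c.+1 + c < b * c.+1 + 1)%N.
  move=> ab; rewrite addn1 ltnS -ltnS -addnS -mulSnr leqW// leq_mul2r.
  by rewrite ab orbT.
move=> inv st; case: st inv => {s s'} /=.
- move=> N Q P z y _ _ _; rewrite ltn_add2l !ltnS; exact: columns_left_le.
- move=> N Q P z y A z' y' [p Ap] AN _ _ [[_ _ _ _] _ [[_ _ y_ge0] _]].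
  have [pN yp] := AN _ Ap.
  rewrite ltn_add2l !ltnS; apply: (@columns_left_lt _ _ p).
  + exact: subsetUl.
  + by case: pN.
  + by move=> /y_ge0; rewrite leNgt yp.
  + by right.
- by move=> N Q P z y _ _; rewrite ltn_add2l.
- by move=> N Q P z zI _ _; rewrite ltn_add2l.
- by move=> N Q P z zI _ _ _; rewrite addn1.
- move=> N Q P z zI nez [[_ PN _ _] [_ zP _ _] _].
  have [|i [n [iN' iN]]] := @ng_update_strict _ _ I N z _ nez.
    by move=> p zp; apply: PN; apply: contrapT => /zP/eqP; rewrite (negbTE zp).
  exact/next_iteration/(unused_room_ng _ iN' iN).
- move=> N Q P z zI S _ _ srcS vS [_ [_ _ _ zQ] _].
  by apply/next_iteration/unused_room_cut/negP => /zQ.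
Qed.

(** By induction on the measure: a maximal run cannot stop before returning. *)
Lemma execution_returns N0 P0 (e : nat -> state (R := R) (V := V)) :
  ng_neighborhood I N0 -> P0 `<=` P_ng I N0 ->
  execution I cuts N0 P0 e -> restricted_lps_feasible I e ->
  exists K z v zI vI, e K = Returned z v zI vI /\ invariant (e K).
Proof.
move=> ngN0 P0N [e0 run] feas.
have inv k : invariant (e k).
  elim: k => [|k IHk].
    by rewrite e0; split=> // S; rewrite finset.inE.
  by case: (run k) => [/(invariant_step IHk)//|[_ ->]].
suff returns m k : (measure (e k) <= m)%N ->
    exists K z v zI vI, e K = Returned z v zI vI.
  have [K [z [v [zI [vI eK]]]]] := returns _ 0%N (leqnn _).
  by exists K, z, v, zI, vI.
elim: m k => [|m IHm] k km; have [st|ret] := progress (inv k) (feas k);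
  try by exists k.
  by case: (run k) => [/(measure_step (inv k))|[]//]; rewrite ltnNge (leq_trans km).
case: (run k) => [/(measure_step (inv k)) lt_k|[]//].
by apply: (IHm k.+1); rewrite -ltnS (leq_trans lt_k).
Qed.

End Termination.

Theorem corollary2 (R : realType) (V : finType) (I : instance R V)
    (N0 : V -> {set V}) (P0 : set (npath (V := V))) :
  ng_neighborhood I N0 ->
  P0 `<=` P_ng I N0 ->
  (forall e, execution I false N0 P0 e -> restricted_lps_feasible I e ->
     exists (K : nat) (z : plan R V) (v : R) (zI : option (plan R V))
       (vI : \bar R),
       e K = Returned z v zI vI /\ v%:E = OPT_lp I (P_elem I)) /\
  (forall e, execution I true N0 P0 e -> restricted_lps_feasible I e ->
     exists (K : nat) (z : plan R V) (v : R) (zI : option (plan R V))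
       (vI : \bar R),
       e K = Returned z v zI vI /\
       (OPT_lp I (P_elem I) <= v%:E <= OPT_ip I (P_elem I))%E).
Proof.
move=> ngN0 P0N; split=> e run feas;
  have [K [z [v [zI [vI [eK inv]]]]]] := execution_returns ngN0 P0N run feas;
  exists K, z, v, zI, vI; split=> //; move: inv; rewrite eK => -[bounds opt].
- exact: opt.
- exact: bounds.
Qed.
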